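(* Let $(X,\rho)$ be a metric space and let $\mathcal{B}$ be a bornology on $X$ with a closed base. Then $$nw(\tau_{\mathcal B})=nw(X,\mathcal B)\cdot d(\tau_{\mathcal B})\qquad\text{and}\qquad nw(\tau^s_{\mathcal B})=nw(X,\mathcal B)\cdot d(\tau^s_{\mathcal B}).$$
   Context: A bornology on a set $X$ is a family $\mathcal B$ of subsets of $X$ that is closed under taking subsets, closed under finite unions, and satisfies $\bigcup\mathcal B=X$. A base of $\mathcal B$ is a subfamily $\mathcal B_0\subset\mathcal B$ such that every $B\in\mathcal B$ is contained in some $B_0\in\mathcal B_0$; $\mathcal B$ has a closed base if it has a base consisting of closed sets (equivalently $\overline B\in\mathcal B$ for all $B\in\mathcal B$). A family $\gamma$ of subsets of $X$ is a $\mathcal B$-network on $X$ if for every $B\in\mathcal B$ and every open $U\supset\overline B$ there is $C\in\gamma$ with $\overline B\subset C\subset U$; $nw(X,\mathcal B)=\aleph_0+\min\{|\gamma|:\gamma\text{ is a }\mathcal B\text{-network on }X\}$. For $B\subset X$ and $\delta>0$, $B^\delta=\{x\in X:\exists b\in B,\ \rho(x,b)<\delta\}$. $C(X)$ is the set of continuous functions $X\to\mathbb R$. The topology $\tau_{\mathcal B}$ on $C(X)$ is induced by the uniformity with basic entourages $[B,\epsilon]=\{(f,g):\forall x\in B,\ |f(x)-g(x)|<\epsilon\}$, and $\tau^s_{\mathcal B}$ by the uniformity with basic entourages $[B,\epsilon]^s=\{(f,g):\exists\delta>0\ \forall x\in B^\delta,\ |f(x)-g(x)|<\epsilon\}$,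 where $B\in\mathcal B$, $\epsilon>0$. For a topology $\tau$ on $C(X)$, $nw(\tau)$ and $d(\tau)$ denote the network weight and the density of $(C(X),\tau)$. Convention: all cardinal functions are taken to be infinite, i.e. $\aleph_0$ is added to their value. *)

(* Defs.v *)
From HB Require Import structures.
From mathcomp Require Import all_boot all_order all_algebra.
From mathcomp Require Import all_classical all_reals all_analysis.

Set Implicit Arguments.
Unset Strict Implicit.
Unset Printing Implicit Defensive.

Import Order.TTheory GRing.Theory Num.Theory.
Import numFieldNormedType.Exports.

Local Open Scope classical_set_scope.
Local Open Scope card_scope.
Local Open Scope ring_scope.

(** Cardinals are represented by sets up to equipotence [#=]; the product of
    the cardinals of A and B is the cardinal of A `*` B. *)

(* A member of F of least cardinality; one exists as soon as F is nonempty,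
   see [min_cardP]. *)
Definition min_card (T : Type) (F : set (set T)) : set T :=
  xget set0 [set A | F A /\ forall A', F A' -> A #<= A'].

(* aleph_0 + min {|A| : A in F} *)
Definition inf_min_card (T : Type) (F : set (set T)) : set (nat + T) :=
  (inl @` [set: nat]) `|` (inr @` min_card F).

(* Cardinals are well ordered: take a maximal set E of choice functions for F
   that are pairwise distinct at every member of F. *)
Lemma min_cardP (T : Type) (F : set (set T)) : F !=set0 ->
  F (min_card F) /\ forall A, F A -> min_card F #<= A.
Proof.
move=> [A0 FA0]; rewrite /min_card; case: xgetP => [A _ //|nmin].
exfalso; pose I := {A : set T | F A}.
pose P (E : set (I -> T)) := (forall e i, E e -> sval i (e i)) /\
  (forall e e' i, E e -> E e' -> e i = e' i -> e = e').
have [E [[EF Einj] Emax]] : exists E, P E /\ forall E', E `<` E' -> ~ P E'.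
  apply: Zorn_bigcup => C CP Ctot; split=> [e i [E CE Ee]|e e' i].
    exact: (CP _ CE).1 Ee.
  move=> [E CE Ee] [E' CE' Ee']; have [EE'|E'E] := Ctot _ _ CE CE'.
    exact: ((CP _ CE').2 _ _ _ (EE' _ Ee) Ee').
  exact: ((CP _ CE).2 _ _ _ Ee (E'E _ Ee')).
have [[i Ei]|nE] := pselect (exists i : I, sval i `<=` [set e i | e in E]).
  apply: (nmin (sval i)); split=> [|A FA]; first exact: svalP.
  have le1 : sval i #<= E.
    by apply: card_le_trans (card_image_le (fun e => e i) E); exact: subset_card_le.
  apply: (card_le_trans le1); pose j : I := exist _ A FA.
  have injE : set_inj E (fun e : I -> T => e j).
    by move=> e e' /set_mem Ee /set_mem Ee' /(Einj _ _ _ Ee Ee').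
  have /card_eqPle[_ le2] := inj_card_eq injE.
  apply: (card_le_trans le2); apply: subset_card_le => _ [e Ee <-].
  exact: EF e j Ee.
have /choice[g gP] : forall i : I, exists x,
    sval i x /\ ~ (exists2 e, E e & e i = x).
  move=> i; apply: contrapT => /forallNP h; apply: nE; exists i => x ix.
  by apply: contrapT => nx; apply: (h x).
pose i0 : I := exist _ A0 FA0.
have nEg : ~ E g by move=> Eg; apply: (gP i0).2; exists g.
apply: (Emax (E `|` [set g])).
  split=> [e Ee|sub]; first by left.
  by apply: nEg; apply: sub; right.
split=> [e i [Ee|->]|e e' i]; [exact: EF|exact: (gP i).1|].
move=> [Ee|->] [Ee'|->] // ee'; first exact: Einj ee'.
- by case: (gP i).2; exists e.
- by case: (gP i).2; exists e'.
Qed.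

Section topological_cardinal_functions.
Variable T : topologicalType.

Definition is_network (N : set (set T)) :=
  forall (x : T) (U : set T), open U -> U x ->
    exists2 C, N C & C x /\ C `<=` U.

Definition nw : set (nat + set T) := inf_min_card is_network.

Definition density : set (nat + T) := inf_min_card (@dense T).

End topological_cardinal_functions.
Arguments nw T : clear implicits.
Arguments density T : clear implicits.

(* [born_set0] is the closure under the empty union; it follows from the other
   conditions unless T is empty. *)
Record bornology (T : Type) := Bornology {
  born : set (set T) ;
  born_set0 : born set0 ;
  born_sub : forall A B, born B -> A `<=` B -> born A ;
  born_setU : forall A B, born A -> born B -> born (A `|` B) ;
  born_cover : \bigcup_(B in born) B = setT }.

Definition bornology_base (T : Type) (B : bornology T) (B0 : set (set T)) :=
  B0 `<=` born B /\ forall A, born B A -> exists2 A0, B0 A0 & A `<=` A0.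

Definition has_closed_base (T : topologicalType) (B : bornology T) :=
  exists2 B0, bornology_base B B0 & B0 `<=` closed.

Definition is_bornology_network (T : topologicalType) (B : bornology T)
    (N : set (set T)) :=
  forall A U, born B A -> open U -> closure A `<=` U ->
    exists2 C, N C & closure A `<=` C /\ C `<=` U.

Definition bornology_nw (T : topologicalType) (B : bornology T) :
  set (nat + set T) := inf_min_card (is_bornology_network B).

Section function_spaces.
Context {R : realType} {X : metricType R}.
Implicit Types (B : bornology X) (A : set X) (e d : R).

Definition enlargement A d : set X := [set x | exists2 a, A a & mdist x a < d].

Local Notation C := (continuousType X R).

Definition basic_ent A e : set (C * C) :=
  [set fg : C * C | forall x, A x -> `|fg.1 x - fg.2 x| < e].

Definition strong_basic_ent A e : set (C * C) :=
  [set fg : C * C | exists2 d, 0 < d &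
    forall x, enlargement A d x -> `|fg.1 x - fg.2 x| < e].

(* C(X) with the topologies tau_B and tau^s_B respectively *)
Definition born_fct B : Type := continuousType X R.
Definition strong_born_fct B : Type := continuousType X R.

HB.instance Definition _ B := Choice.on (born_fct B).
HB.instance Definition _ B := Choice.on (strong_born_fct B).

Definition born_ent B : set_system (born_fct B * born_fct B) :=
  [set E | exists A e, [/\ born B A, 0 < e & basic_ent A e `<=` E]].
Arguments born_ent B : clear implicits.

Definition strong_born_ent B :
    set_system (strong_born_fct B * strong_born_fct B) :=
  [set E | exists A e, [/\ born B A, 0 < e & strong_basic_ent A e `<=` E]].
Arguments strong_born_ent B : clear implicits.

Lemma born_ent_filter B : Filter (born_ent B).
Proof.
split.
- by exists set0, 1; split => //; exact: born_set0.
- move=> P Q [A [e [BA e0 AP]]] [A' [e' [BA' e'0 AQ]]].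
  exists (A `|` A'), (Order.min e e'); split.
  + exact: born_setU.
  + by rewrite lt_min e0.
  + move=> fg H; split; [apply: AP|apply: AQ] => x Ax.
      by have := H x (or_introl Ax); rewrite lt_min => /andP[].
    by have := H x (or_intror Ax); rewrite lt_min => /andP[].
- by move=> P Q PQ [A [e [BA e0 AP]]]; exists A, e; split => // fg /AP/PQ.
Qed.

Lemma born_ent_diagonal B E : born_ent B E -> diagonal `<=` E.
Proof.
move=> [A [e [_ e0 AE]]] [f g] /= fg; apply: AE => x _ /=.
by move: fg; rewrite /diagonal/= => ->; rewrite subrr normr0.
Qed.

Lemma born_ent_inv B E : born_ent B E -> born_ent B E^-1%relation.
Proof.
move=> [A [e [BA e0 AE]]]; exists A, e; split => // -[f g] H.
by apply: AE => x /H /=; rewrite distrC.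
Qed.

Lemma born_ent_split B E : born_ent B E ->
  exists2 E', born_ent B E' & (E' \; E' `<=` E)%relation.
Proof.
move=> [A [e [BA e0 AE]]]; exists (basic_ent A (e / 2)).
  by exists A, (e / 2); split => //; rewrite divr_gt0.
move=> [f g] [h /= fh hg]; apply: AE => x Ax /=.
rewrite (le_lt_trans (ler_distD (h x) _ _))// (splitr e).
by rewrite ltrD//; [exact: fh|exact: hg].
Qed.

HB.instance Definition _ B := isUniform.Build (born_fct B)
  (born_ent_filter B) (@born_ent_diagonal B) (@born_ent_inv B)
  (@born_ent_split B).

Lemma strong_born_ent_filter B : Filter (strong_born_ent B).
Proof.
split.
- by exists set0, 1; split => //; exact: born_set0.
- move=> P Q [A [e [BA e0 AP]]] [A' [e' [BA' e'0 AQ]]].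
  exists (A `|` A'), (Order.min e e'); split.
  + exact: born_setU.
  + by rewrite lt_min e0.
  + move=> fg [d d0 H]; split; [apply: AP|apply: AQ]; exists d => // x [a Aa xa].
      by have := H x (ex_intro2 _ _ a (or_introl Aa) xa); rewrite lt_min => /andP[].
    by have := H x (ex_intro2 _ _ a (or_intror Aa) xa); rewrite lt_min => /andP[].
- by move=> P Q PQ [A [e [BA e0 AP]]]; exists A, e; split => // fg /AP/PQ.
Qed.

Lemma strong_born_ent_diagonal B E : strong_born_ent B E -> diagonal `<=` E.
Proof.
move=> [A [e [_ e0 AE]]] [f g] /= fg; apply: AE; exists 1 => // x _ /=.
by move: fg; rewrite /diagonal/= => ->; rewrite subrr normr0.
Qed.

Lemma strong_born_ent_inv B E :
  strong_born_ent B E -> strong_born_ent B E^-1%relation.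
Proof.
move=> [A [e [BA e0 AE]]]; exists A, e; split => // -[f g] [d d0 H].
by apply: AE; exists d => // x /H /=; rewrite distrC.
Qed.

Lemma strong_born_ent_split B E : strong_born_ent B E ->
  exists2 E', strong_born_ent B E' & (E' \; E' `<=` E)%relation.
Proof.
move=> [A [e [BA e0 AE]]]; exists (strong_basic_ent A (e / 2)).
  by exists A, (e / 2); split => //; rewrite divr_gt0.
move=> [f g] [h /= [d d0 fh] [d' d'0 hg]].
apply: AE; exists (Order.min d d'); first by rewrite lt_min d0.
move=> x [a Aa]; rewrite lt_min => /andP[xd xd'] /=.
rewrite (le_lt_trans (ler_distD (h x) _ _))// (splitr e).
by rewrite ltrD//; [apply: fh|apply: hg]; exists a.
Qed.

HB.instance Definition _ B := isUniform.Build (strong_born_fct B)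
  (strong_born_ent_filter B) (@strong_born_ent_diagonal B)
  (@strong_born_ent_inv B) (@strong_born_ent_split B).

End function_spaces.
Arguments born_ent {R X} B _.
Arguments strong_born_ent {R X} B _.

(* Main.v *)
Require Import Defs.
From mathcomp Require Import all_boot all_order all_algebra.
From mathcomp Require Import all_classical all_reals all_analysis.

(** The inequality [d <= nw] is general, and a network of the function space
    yields a B-network of the same size: if u is 0 on the closure of A and 1
    off O, a network member P with u in P and P included in the 1-neighbourhood
    of u on the closure of A gives the set {x | v x < 1 for all v in P}, which
    lies between the closure of A and O.  Since k * k = k for infinite k,
    nw(X, B) * d <= nw.  Conversely, for C in a B-network, g in a dense set and
    n in nat, the sets of u that are 1/(n+1)-close to g on C form a network:
    given f and A, choose g close to f on the closure of A, and then C between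
    this closure and an open set on which g is still close to f.  For the
    strong topology that open set is a smaller enlargement of the closure. *)

Set Implicit Arguments.
Unset Strict Implicit.
Unset Printing Implicit Defensive.

Local Open Scope classical_set_scope.
Local Open Scope card_scope.

(** * Arithmetic of infinite cardinals *)

(** Relations spare the construction of functions on subtypes: [r] may be multivalued, because
    injectivity survives any choice of values. *)
Lemma card_leRP T U (A : set T) (B : set U) :
  A #<= B <-> exists r : T -> U -> Prop,
    (forall a, A a -> exists2 b, B b & r a b) /\
    (forall a a' b, r a b -> r a' b -> a = a').
Proof.
split=> [/card_leP[f]|[r [rAB rinj]]].
  exists (fun a b => exists x : A, \val x = a /\ \val (f x) = b).
  split=> [a Aa|a a' b].
    pose x : A := SigSub (mem_set Aa).
    by exists (\val (f x)); [exact: set_mem (valP (f x))|exists x].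
  move=> [x [<- <-]] [x' [<- /val_inj fxx']]; congr (\val _).
  by have := @inj _ _ _ f x' x (in_setT x') (in_setT x) fxx' => ->.
have /choice[f fP] : forall x : A, exists y : B, r (\val x) (\val y).
  move=> x; have [b Bb rb] := rAB _ (set_mem (valP x)).
  by exists (SigSub (mem_set Bb)).
apply/card_leP; apply/injfunPex; exists f => // x x' _ _ fxx'.
by apply/val_inj; apply: rinj (fP x) _; rewrite fxx'.
Qed.

(** Copies of both sets in the sum type form a two-element family; its member of least cardinality
    embeds in the other. *)
Lemma card_le_total T U (A : set T) (B : set U) : A #<= B \/ B #<= A.
Proof.
pose A' : set (T + U) := inl @` A; pose B' : set (T + U) := inr @` B.
have A'A : A' #= A by apply: inj_card_eq => ? ? _ _ [].
have B'B : B' #= B by apply: inj_card_eq => ? ? _ _ [].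
have [|F minF] := @min_cardP _ [set A'; B']; first by exists A'; left.
have := minF A' (or_introl erefl); have := minF B' (or_intror erefl).
case: F => -> le1 le2; [left|right].
  by rewrite -(card_le_eql A'A) -(card_le_eqr B'B).
by rewrite -(card_le_eql B'B) -(card_le_eqr A'A).
Qed.

Lemma card_leX T T' U U' (A : set T) (B : set T') (C : set U) (D : set U') :
  A #<= C -> B #<= D -> A `*` B #<= C `*` D.
Proof.
move=> /card_leRP[r [rAC rinj]] /card_leRP[s [sBD sinj]]; apply/card_leRP.
exists (fun p q => r p.1 q.1 /\ s p.2 q.2); split=> [[a b] [/= Aa Bb]|].
  by have [c Cc ac] := rAC _ Aa; have [d Dd bd] := sBD _ Bb; exists (c, d).
by move=> [a b] [a' b'] [c d] /= [/rinj ac /sinj bd] [/ac -> /bd ->].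
Qed.

Lemma card_lePl T U (A : set T) (B : set U) : B !=set0 -> A #<= A `*` B.
Proof.
move=> [b Bb]; apply/card_leRP; exists (fun a p => p = (a, b)).
by split=> [a Aa|a a' p -> [->] //]; exists (a, b).
Qed.

(** Two distinct points [c] and [d] of [C] tag the elements of [A] and of [B], which embeds the
    union in the square of [C]. *)
Lemma card_leU_square T U (A B : set T) (C : set U) : infinite_set C ->
  C `*` C #<= C -> A #<= C -> B #<= C -> A `|` B #<= C.
Proof.
move=> Cinf CC /card_leRP[r [rA rinj]] /card_leRP[s [sB sinj]].
apply: card_le_trans CC.
have /card_leRP[h [hC hinj]] := (infiniteP C).1 Cinf.
have [c Cc hc] := hC 0%N I; have [d Dd hd] := hC 1%N I.
have cd : c <> d.
  by move=> cd; have := hinj 0%N 1%N d; rewrite -{1}cd => /(_ hc hd).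
apply/card_leRP.
exists (fun x p => p.1 = c /\ r x p.2 \/ p.1 = d /\ s x p.2); split.
  move=> x [/rA[y Cy xy]|/sB[y Cy xy]]; first by exists (c, y) => //; left.
  by exists (d, y) => //; right.
move=> x x' [y z] /= [[-> xz]|[-> xz]] [[e xz']|[e xz']].
- exact: rinj xz xz'.
- by case: cd.
- by case: cd.
- exact: sinj xz xz'.
Qed.

(** Zorn's lemma is applied to the sets [M] with [P (A0]|[M)], so that the empty chain is bounded by
    [A0] itself. *)
Lemma Zorn_bigcup_above (T : Type) (P : set (set T)) (A0 : set T) :
  P A0 ->
  (forall F, F !=set0 -> F `<=` P -> total_on F subset ->
    P (\bigcup_(X in F) X)) ->
  exists M, [/\ P M, A0 `<=` M & forall M', P M' -> M `<=` M' -> M' `<=` M].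
Proof.
move=> PA0 chainP.
have [M [PM Mmax]] : exists M, P (A0 `|` M) /\
    forall M', M `<` M' -> ~ P (A0 `|` M').
  apply: (@Zorn_bigcup _ (fun M => P (A0 `|` M))) => F FP Ftot.
  have [->|/set0P[X0 FX0]] := eqVneq F set0.
    by rewrite bigcup_set0 setU0.
  have -> : A0 `|` \bigcup_(X in F) X =
      \bigcup_(Y in (setU A0 @` F)) Y.
    rewrite bigcup_image; apply/seteqP; split=> x.
      by move=> [A0x|[X FX Xx]]; [exists X0 => //; left|exists X => //; right].
    by move=> [X FX [A0x|Xx]]; [left|right; exists X].
  apply: chainP.
  - by exists (A0 `|` X0); exists X0.
  - by move=> _ [X FX <-]; exact: FP.
  - move=> _ _ [X FX <-] [Y FY <-].
    by have [XY|YX] := Ftot _ _ FX FY; [left|right]; exact: setUS.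
exists (A0 `|` M); split=> // M' PM' MM'; apply: contrapT => nM'.
apply: (Mmax M').
  split; first by move=> x Mx; apply: MM'; right.
  by move=> M'M; apply: nM' => x /M'M; right.
suff -> : A0 `|` M' = M' by [].
by apply/setUidPr => x A0x; apply: MM'; left.
Qed.

(** * Squares of infinite sets *)

Section square.
Variables (T : Type) (A : set T).

Let dom (G : set (T * T * T)) : set T := [set x | exists z, G (x, x, z)].

(* [G] is the graph of a possibly multivalued injection from the square of
   [dom G] to [dom G]; reading the carrier off the diagonal leaves Zorn's lemma
   with a single set to maximize. *)
Let square (G : set (T * T * T)) := [/\
  dom G `<=` A,
  forall x y, dom G x -> dom G y -> exists z, G (x, y, z),
  forall x y z, G (x, y, z) -> [/\ dom G x, dom G y & dom G z] &
  forall p q z, G (p, z) -> G (q, z) -> p = q].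

Let square_card G : square G -> dom G `*` dom G #<= dom G.
Proof.
move=> [_ Gtot Gdom Ginj]; apply/card_leRP.
exists (fun p z => G (p, z)).
split=> [[x y] [/= dx dy]|p q z]; last exact: Ginj.
by have [z Gz] := Gtot _ _ dx dy; exists z => //; have [] := Gdom _ _ _ Gz.
Qed.

(** The starting point for Zorn's lemma: an injection of [nat * nat] into [nat], carried to [A]
    along an injective sequence [f]. *)
Let square_nat : infinite_set A -> exists2 G, square G & infinite_set (dom G).
Proof.
move=> /infiniteP/card_leRP[h [hA hinj]].
have /choice[f fP] : forall n, exists a, A a /\ h n a.
  by move=> n; have [a] := hA n I; exists a.
have finj : injective f.
  by move=> m n fmn; apply: hinj (fP m).2 _; rewrite fmn; exact: (fP n).2.
have /card_eqPle[/card_leRP[s [sP sinj]] _] := card_nat2.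
pose G : set (T * T * T) :=
  [set t | exists m n k, t = (f m, f n, f k) /\ s (m, n) k].
have domf n : dom G (f n).
  by have [k _ nk] := sP (n, n) I; exists (f k), n, n, k.
exists G.
  split.
  - by move=> x [z [m [n [k [[-> _ _] _]]]]]; exact: (fP m).1.
  - move=> x y [? [m [? [? [[-> _ _] _]]]]] [? [n [? [? [[-> _ _] _]]]]].
    by have [k _ mnk] := sP (m, n) I; exists (f k), m, n, k.
  - by move=> x y z [m [n [k [[-> -> ->] _]]]].
  - move=> p q z [m [n [k [[-> ->] mnk]]]] [m' [n' [k' [[-> /finj kk']]]]].
    by rewrite -kk' => /(sinj _ _ _ mnk)[-> ->].
apply/infiniteP/card_leRP; exists (fun n x => x = f n).
by split=> [n _|m n x -> /finj //]; exists (f n).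
Qed.

(* When [E] is disjoint from [dom G], send the new pairs into [E]. *)
Let square_extend G (E : set T) : square G -> E `<=` A -> E !=set0 ->
  E `&` dom G = set0 -> (dom G `|` E) `*` (dom G `|` E) #<= E ->
  exists2 G', square G' & G `<=` G' /\ ~ (G' `<=` G).
Proof.
move=> [GA Gtot Gdom Ginj] EA [e Ee] EG /card_leRP[r [rE rinj]].
have disj x : E x -> dom G x -> False.
  by move=> Ex Gx; have : (E `&` dom G) x by []; rewrite EG.
pose S := dom G `|` E.
pose G' : set (T * T * T) := [set t | G t \/
  [/\ (S `*` S) t.1, ~ (dom G `*` dom G) t.1, E t.2 & r t.1 t.2]].
have totG' x y : S x -> S y -> exists z, G' (x, y, z).
  move=> Sx Sy; have [[dx dy]|nd] := pselect ((dom G `*` dom G) (x, y)).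
    by have [z] := Gtot _ _ dx dy; exists z; left.
  by have [|z Ez rz] := rE (x, y); [split|exists z; right].
have domG' : dom G' = S.
  apply/seteqP; split=> [x [z [Gx|[[] //]]]|x Sx]; last exact: totG'.
  by left; exists z.
exists G'; rewrite /square ?domG'.
  split=> //.
  - by move=> x [|]; [exact: GA|exact: EA].
  - move=> x y z [/Gdom[? ? ?]|[[? ?] _ Ez _]]; first by split; left.
    by split=> //; right.
  - move=> [x y] [x' y'] z.
    move=> [Gz|[_ _ Ez rz]] [Gz'|[_ _ Ez' rz']].
    + exact: Ginj Gz Gz'.
    + by case: (disj _ Ez'); have [] := Gdom _ _ _ Gz.
    + by case: (disj _ Ez); have [] := Gdom _ _ _ Gz'.
    + exact: rinj rz rz'.
split=> [t|G'G]; first by left.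
(* The extension is proper: [G'] has a value at [(e, e)], whereas [e] lies outside [dom G]. *)
have [z /G'G Gz] := totG' e e (or_intror Ee) (or_intror Ee).
by apply: (disj e Ee); exists z.
Qed.

(** For a maximal [M], the rest of [A] cannot be as large as [dom M], since a copy of [dom M] in it
    would allow an extension. So the rest embeds in [dom M], and hence so does [A]. *)
Lemma card_square : infinite_set A -> A `*` A #<= A.
Proof.
move=> Ainf; have [G0 sqG0 G0inf] := square_nat Ainf.
have [|M [sqM G0M Mmax]] := Zorn_bigcup_above sqG0.
  move=> F _ FP Ftot.
  have domFE x : dom (\bigcup_(X in F) X) x -> exists2 G, F G & dom G x.
    by move=> [z [G FG Gx]]; exists G => //; exists z.
  split.
  - by move=> x /domFE[G /FP[GA _ _ _] /GA].
  - move=> x y /domFE[G FG Gx] /domFE[H FH Hy].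
    have [GH|HG] := Ftot _ _ FG FH.
      have Hx : dom H x by case: Gx => z /GH; exists z.
      have [_ Htot _ _] := FP _ FH.
      by have [z] := Htot _ _ Hx Hy; exists z, H.
    have Gy : dom G y by case: Hy => z /HG; exists z.
    have [_ Gtot _ _] := FP _ FG.
    by have [z] := Gtot _ _ Gx Gy; exists z, G.
  - move=> x y z [G FG Gxyz]; have [_ _ Gdom _] := FP _ FG.
    have [[a ?] [b ?] [c ?]] := Gdom _ _ _ Gxyz.
    by split; [exists a, G|exists b, G|exists c, G].
  - move=> p q z [G FG Gpz] [H FH Hqz].
    have [GH|HG] := Ftot _ _ FG FH.
      by have [_ _ _ Hinj] := FP _ FH; exact: Hinj (GH _ Gpz) Hqz.
    by have [_ _ _ Ginj] := FP _ FG; exact: Ginj Gpz (HG _ Hqz).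
have [MA _ _ _] := sqM.
have domM : infinite_set (dom M).
  by apply: sub_infinite_set G0inf => x [z /G0M]; exists z.
have MM := square_card sqM.
have leM (B C : set T) := @card_leU_square _ _ B C _ domM MM.
have [le|le] := card_le_total (A `\` dom M) (dom M).
  have AM : A #<= dom M.
    apply: card_le_trans (leM _ _ le (card_lexx _)).
    apply: subset_card_le => x Ax.
    by have [|nMx] := pselect (dom M x); [right|left].
  apply: card_le_trans (card_leX AM AM) (card_le_trans MM _).
  exact: subset_card_le.
exfalso; have /card_leRP[r [rM rinj]] := le.
have /choice[f fP] : forall x, exists y, dom M x -> (A `\` dom M) y /\ r x y.
  (* Outside [dom M] the value of [f] is arbitrary; [x] itself serves. *)
  move=> x; have [Mx|nMx] := pselect (dom M x); last by exists x.
  by have [y Ay rxy] := rM _ Mx; exists y.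
pose E := f @` dom M.
have EM : E #= dom M.
  apply: inj_card_eq => x y /set_mem Mx /set_mem My fxy.
  by apply: rinj (fP x Mx).2 _; rewrite fxy; exact: (fP y My).2.
have EA : E `<=` A by move=> _ [x Mx <-]; have [[]] := fP x Mx.
have [G sqG [MG GM]] : exists2 G, square G & M `<=` G /\ ~ (G `<=` M).
  apply: (square_extend sqM EA).
  - by have [x Mx] := infinite_setN0 domM; exists (f x); exists x.
  - by rewrite -subset0 => _ [[x Mx <-] Mfx]; have [[]] := fP x Mx.
  - have /card_eqPle[leE ME] := EM; have le2 := leM _ _ (card_lexx _) leE.
    exact: card_le_trans (card_leX le2 le2) (card_le_trans MM ME).
exact: GM (Mmax _ sqG MG).
Qed.

End square.

Lemma inf_min_card_infinite T (F : set (set T)) : infinite_set (inf_min_card F).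
Proof.
apply/infiniteP/card_leRP; exists (fun n x => x = inl n).
by split=> [n _|m n x -> [] //]; exists (inl n) => //; left; exists n.
Qed.

Lemma inf_min_card_ge T (F : set (set T)) : min_card F #<= inf_min_card F.
Proof.
apply/card_leRP; exists (fun x y => y = inr x).
by split=> [x Fx|x x' y -> [] //]; exists (inr x) => //; right; exists x.
Qed.

(** The tool for every upper bound below: one member of [F] of size at most [K] suffices, the added
    [nat] being absorbed by the infinite [K]. *)
Lemma inf_min_card_le T U (F : set (set T)) (A : set T) (K : set U) :
  infinite_set K -> F A -> A #<= K -> inf_min_card F #<= K.
Proof.
move=> Kinf FA AK; have [_ minF] := min_cardP (ex_intro _ _ FA).
apply: card_leU_square => //.
- exact: card_square.
- exact: card_le_trans (card_image_le _ _) ((infiniteP K).1 Kinf).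
- exact: card_le_trans (card_image_le _ _) (card_le_trans (minF _ FA) AK).
Qed.

(** * Networks and dense sets *)

Lemma min_network (T : topologicalType) :
  is_network (min_card (@is_network T)).
Proof.
have [|? _ //] := @min_cardP _ (@is_network T).
by exists setT => x U _ Ux; exists U => //; split.
Qed.

Lemma min_dense (T : topologicalType) : dense (min_card (@dense T)).
Proof.
have [|? _ //] := @min_cardP _ (@dense T).
by exists setT => U U0 _; rewrite setIT.
Qed.

Lemma min_bornology_network (T : topologicalType) (B : bornology T) :
  is_bornology_network B (min_card (is_bornology_network B)).
Proof.
have [|? _ //] := @min_cardP _ (is_bornology_network B).
by exists setT => A U _ _ AU; exists (closure A) => //; split.
Qed.

(** One point chosen from each member of a network gives a dense set. The default [x0] covers empty
    members; an empty space is treated apart. *)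
Lemma density_le_nw (T : topologicalType) : density T #<= nw T.
Proof.
pose N := min_card (@is_network T).
have [[x0 _]|T0] := pselect (exists x : T, True).
  apply: (@inf_min_card_le T _ (@dense T) (xget x0 @` N)).
  - exact: inf_min_card_infinite.
  - move=> O [x Ox] oO; have [C NC [Cx CO]] := min_network oO Ox.
    exists (xget x0 C).
    by split; [apply: CO; apply: (xgetPex x0); exists x|exists C].
  - exact: card_le_trans (card_image_le _ _) (inf_min_card_ge _).
apply: (@inf_min_card_le T _ (@dense T) set0) => //.
  exact: inf_min_card_infinite.
by move=> O [x _]; case: T0; exists x.
Qed.

Lemma closed_base_closure (T : topologicalType) (B : bornology T) A :
  has_closed_base B -> born B A -> born B (closure A).
Proof.
move=> [B0 [B0B B0cof] B0cl] /B0cof[A0 B0A0 AA0].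
apply: born_sub (B0B _ B0A0) _.
by have /closure_id -> := B0cl _ B0A0; exact: closureS.
Qed.

(** * Networks of the function space and B-networks *)

Section function_space.
Import Order.TTheory GRing.Theory Num.Theory.
Import numFieldNormedType.Exports.
Local Open Scope ring_scope.
Context {R : realType} {X : metricType R} (B : bornology X).
Hypothesis closureB : forall A, born B A -> born B (closure A).

Section entourages.
(** An abstract setting for both topologies at once: [phi] reads a point of [U] as a function, and
    [V A e] stands for either kind of basic entourage. *)
Context (U : uniformType) (phi : U -> X -> R) (V : set X -> R -> set (U * U)).
Hypothesis phi_surj : forall f : X -> R, continuous f -> exists u, phi u = f.
Hypothesis Vsym : forall A e u v, V A e (u, v) -> V A e (v, u).
Hypothesis Vtri : forall A d e u v w,
  V A d (u, v) -> V A e (v, w) -> V A (d + e) (u, w).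
Hypothesis Vanti : forall A A' e, A `<=` A' -> V A' e `<=` V A e.
Hypothesis Vmono : forall A d e, d <= e -> V A d `<=` V A e.
Hypothesis Vent : forall A e, born B A -> 0 < e -> entourage (V A e).
Hypothesis entV : forall E, entourage E ->
  exists A e, [/\ born B A, 0 < e & V A e `<=` E].
(** Closeness on a closure spreads to an open set around it, which leaves room for a member of the
    B-network. *)
Hypothesis Vopen : forall A e u v, V (closure A) e (u, v) -> exists O,
  [/\ open O, closure A `<=` O & forall C, C `<=` O -> V C e (u, v)].
Hypothesis Vphi : forall A e u v, V A e (u, v) ->
  forall x, A x -> `|phi u x - phi v x| < e.

Lemma bornology_nw_le_nw : bornology_nw B #<= nw U.
Proof.
have phi_nbhs A u : born B A ->
    nbhs u [set v | forall x, A x -> `|phi u x - phi v x| < 1].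
  move=> BA; apply: filterS (nbhs_entourage u (Vent BA ltr01)) => v.
  by rewrite /xsection/= inE => Vuv x; exact: Vphi.
pose N := min_card (@is_network U).
pose below (P : set U) := [set x | forall v, P v -> phi v x < 1].
apply: (@inf_min_card_le _ _ (is_bornology_network B) (below @` N)).
- exact: inf_min_card_infinite.
- move=> A O BA oO AO.
  (* Urysohn's lemma, from the normality of metric spaces. *)
  have [f [cf _ f0 f1]] : exists f : X -> R, [/\ continuous f,
      range f `<=` `[0, 1], f @` closure A `<=` [set 0] &
      f @` (~` O) `<=` [set 1]].
    apply/uniform_separatorP.
    apply: ((@normal_separatorP R X).1 (@pseudometric_normal R X)).
    - exact: closed_closure.
    - exact: open_closedC.
    - by rewrite -subset0 => x [/AO].
  have [u phiu] := phi_surj cf.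
  (* The closed base enters here: closeness on the closure of [A] defines a neighbourhood only if
     this closure is in the bornology. *)
  have := phi_nbhs _ u (closureB BA).
  rewrite nbhsE; case=> Q [oQ Qu] Qsub.
  have [P NP [Pu PQ]] := min_network oQ Qu.
  exists (below P); first by exists P.
  split=> [x Ax v Pv|x /(_ u Pu)].
    have := Qsub _ (PQ _ Pv) x Ax; rewrite phiu.
    have -> : f x = 0 by apply: f0; exists x.
    by rewrite sub0r normrN; apply: le_lt_trans; exact: ler_norm.
  (* Since [u] is in [P], a point of [below P] has [f x < 1], which fails off [O]. *)
  rewrite phiu => fx; apply: contrapT => Ox.
  have : f x = 1 by apply: f1; exists x.
  by move=> fx1; rewrite fx1 ltxx in fx.
- exact: card_le_trans (card_image_le _ _) (inf_min_card_ge _).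
Qed.

Lemma nw_le_bornology_nw_density : nw U #<= bornology_nw B `*` density U.
Proof.
pose N := min_card (is_bornology_network B); pose D := min_card (@dense U).
pose W (t : set X * U * nat) := [set u | V t.1.1 t.2.+1%:R^-1 (t.1.2, u)].
have pinf : infinite_set (bornology_nw B `*` density U).
  apply/infiniteP; apply: card_le_trans.
    exact/infiniteP/(@inf_min_card_infinite _ (is_bornology_network B)).
  by apply: card_lePl; apply: infinite_setN0; exact: inf_min_card_infinite.
apply: (@inf_min_card_le _ _ (@is_network U)
  (W @` (N `*` D `*` [set: nat]))) => //.
  move=> u O oO Ou.
  have /nbhsP[E entE EO] : nbhs u O by exact: open_nbhs_nbhs.
  have [A [e [BA e0 VE]]] := entV entE.
  (* With this [n], [n.+1] exceeds [2 / e], so two errors of size [d] add up to at most [e]. *)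
  pose n := Num.truncn (2 / e).
  pose d : R := n.+1%:R^-1.
  have d0 : 0 < d by rewrite invr_gt0.
  have de : d + d <= e.
    rewrite [leRHS]splitr -(invf_div 2 e) lerD// lef_pV2 ?posrE ?divr_gt0//;
      exact: ltW (truncnS_gt _).
  have : nbhs u (xsection (V (closure A) d) u).
    by apply: nbhs_entourage; exact: Vent (closureB BA) d0.
  rewrite nbhsE; case=> Q [oQ Qu] QV.
  have [g [Qg Dg]] := @min_dense U Q (ex_intro _ _ Qu) oQ.
  have Vug : V (closure A) d (u, g).
    by have := QV _ Qg; rewrite /xsection/= inE.
  have [Z [oZ AZ ZV]] := Vopen Vug.
  have [C NC [AC CZ]] := min_bornology_network BA oZ AZ.
  exists (W (C, g, n)); first by exists (C, g, n).
  split; first by apply: Vsym; exact: ZV.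
  move=> w Vgw; apply: EO; rewrite /xsection/= inE; apply: VE.
  (* On [A], [u] is compared with [g] through the closure of [A], and [g] with [w] through [C],
     which contains that closure. *)
  apply: (Vmono de); apply: Vtri.
    by apply: Vanti Vug; exact: subset_closure.
  by apply: Vanti Vgw => x /subset_closure/AC.
apply: card_le_trans (card_image_le _ _) _.
(* The product is replaced by its square: one copy bounds [N] times [D], the other absorbs [nat]. *)
apply: card_le_trans (card_square pinf); apply: card_leX.
  by apply: card_leX; exact: inf_min_card_ge.
exact/infiniteP.
Qed.

Lemma nw_bornology_density : nw U #= bornology_nw B `*` density U.
Proof.
apply/card_eqPle; split; first exact: nw_le_bornology_nw_density.
apply: card_le_trans (card_square (@inf_min_card_infinite _ (@is_network U))).
exact: card_leX bornology_nw_le_nw (density_le_nw U).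
Qed.

End entourages.

(** * The two topologies on [C(X)] *)

Lemma nw_born_fct :
  nw (born_fct B) #= bornology_nw B `*` density (born_fct B).
Proof.
apply: (@nw_bornology_density _
  (fun u : born_fct B => (u : continuousType X R) : X -> R) (@basic_ent R X)).
- by move=> f cf; exists (mkcts cf : continuousType X R).
- by move=> A e u v Vuv x Ax /=; rewrite distrC; exact: Vuv.
- move=> A d e u v w Vuv Vvw x Ax /=.
  rewrite (le_lt_trans (ler_distD (v x) _ _))// ltrD//.
    exact: Vuv.
  exact: Vvw.
- by move=> A A' e AA' [u v] Vuv x /AA'; exact: Vuv.
- by move=> A d e de [u v] Vuv x Ax; exact: lt_le_trans (Vuv x Ax) de.
- by move=> A e BA e0; exists A, e; split.
- by [].
(* By continuity, the set where [u] and [v] are [e]-close is already open. *)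
- move=> A e u v Vuv; exists [set x | `|u x - v x| < e]; split=> //.
  have cuv : continuous (fun x => `|u x - v x|).
    move=> x; apply: cvg_norm; apply: cvgB; exact: cts_fun.
  apply: (@open_comp _ _ _ [set y | y < e]) => [x _|]; first exact: cuv.
  exact: open_lt.
- by [].
Qed.

Lemma nw_strong_born_fct :
  nw (strong_born_fct B) #= bornology_nw B `*` density (strong_born_fct B).
Proof.
apply: (@nw_bornology_density _
  (fun u : strong_born_fct B => (u : continuousType X R) : X -> R)
  (@strong_basic_ent R X)).
- by move=> f cf; exists (mkcts cf : continuousType X R).
- move=> A e u v [d d0 Vuv].
  by exists d => // x Ax /=; rewrite distrC; exact: Vuv.
- move=> A e e' u v w [d d0 Vuv] [d' d'0 Vvw].
  exists (Order.min d d'); first by rewrite lt_min d0.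
  move=> x [a Aa]; rewrite lt_min => /andP[xd xd'] /=.
  rewrite (le_lt_trans (ler_distD (v x) _ _))// ltrD//.
    by apply: Vuv; exists a.
  by apply: Vvw; exists a.
- move=> A A' e AA' [u v] [d d0 Vuv]; exists d => // x [a /AA' A'a xa].
  by apply: Vuv; exists a.
- move=> A e e' ee' [u v] [d d0 Vuv].
  by exists d => // x /Vuv /lt_le_trans; apply.
- by move=> A e BA e0; exists A, e; split.
- by [].
- move=> A e u v [d d0 Vuv].
  (* Halving the radius leaves room for a further enlargement: if [C] lies in this open set, the
     [d / 2]-enlargement of [C] lies in the [d]-enlargement of the closure of [A]. *)
  exists (\bigcup_(a in closure A) (ball a (d / 2))°); split.
  + by apply: bigcup_open => a _; exact: open_interior.
  + by move=> x Ax; exists x => //; apply: nbhsx_ballx; rewrite divr_gt0.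
  + move=> C CO; exists (d / 2); first by rewrite divr_gt0.
    move=> x [c /CO[a Aa /interior_subset]]; rewrite ballEmdist/= => ac xc.
    apply: Vuv; exists a => //.
    rewrite (le_lt_trans (metric_triangle _ c _))// (splitr d) ltrD//.
    by rewrite metric_sym.
- move=> A e u v [d d0 Vuv] x Ax; apply: Vuv.
  by exists x => //; rewrite mdistxx.
Qed.

End function_space.

Theorem theorem3p8 (R : realType) (X : metricType R) (B : bornology X)
    (hB : has_closed_base B) :
  nw (born_fct B) #= bornology_nw B `*` density (born_fct B) /\
  nw (strong_born_fct B) #= bornology_nw B `*` density (strong_born_fct B).
Proof.
have closureB A := @closed_base_closure _ _ A hB.
by split; [exact: nw_born_fct|exact: nw_strong_born_fct].
Qed.
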